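(* Let $\mathbb{A}=(\mathcal{A},\leq,\to,\Sigma)$ be an implicative algebra, let $\mathsf{P}:\mathsf{Set}^{\mathrm{op}}\to\mathsf{Hey}$ be its implicative tripos, let $I$ be a set, and let $\varphi$ be a predicate of $\mathsf{P}(I)$ (represented by a function $\varphi:I\to\mathcal{A}$). Then: 1. $\varphi$ is a uniformly supercompact predicate ($\mathbf{U\text{-}SK_p}$) if and only if the family $(\varphi(i))_{i\in I}$ is uniformly supercompact ($\mathbf{U\text{-}SK}$); 2. $\varphi$ is a uniformly functionally supercompact predicate ($\mathbf{U\text{-}fSK_p}$) if and only if the family $(\varphi(i))_{i\in I}$ is uniformly functionally supercompact ($\mathbf{U\text{-}fSK}$); 3. $\varphi$ is a uniformly weakly functionally supercompact predicate ($\mathbf{U\text{-}wfSK_p}$) if and only if the family $(\varphi(i))_{i\in I}$ is uniformly weakly functionally supercompact ($\mathbf{U\text{-}wfSK}$).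
   Context: Implicative algebras. An implicative algebra $\mathbb{A}=(\mathcal{A},\leq,\to,\Sigma)$ is a complete lattice $(\mathcal{A},\leq)$ with a binary operation $\to$ (associating to the right) such that (i) $a'\leq a$ and $b\leq b'$ imply $a\to b\leq a'\to b'$, and (ii) $a\to\bigwedge_{b\in B}b=\bigwedge_{b\in B}(a\to b)$ for all $a\in\mathcal{A}$, $B\subseteq\mathcal{A}$; together with a separator $\Sigma\subseteq\mathcal{A}$, i.e. a subset that is upward closed, contains $\bigwedge_{a,b}(a\to b\to a)$ and $\bigwedge_{a,b,c}((a\to b\to c)\to(a\to b)\to a\to c)$, and satisfies: $a\to b\in\Sigma$ and $a\in\Sigma$ imply $b\in\Sigma$. $\top,\bot$ are the maximum and minimum. Define $$a\times b:=\bigwedge_{x\in\mathcal{A}}((a\to(b\to x))\to x),\qquad \exists_{i\in I}c_i:=\bigwedge_{x\in\mathcal{A}}\Big(\bigwedge_{i\in I}(c_i\to x)\to x\Big),$$ and for a set $J$ and $j,j'\in J$: $\delta_J(j,j'):=\bigwedge_{x\in\mathcal{A}}((\top\to x)\to x)$ if $j=j'$, and $\delta_J(j,j'):=\top\to\bot$ if $j\neq j'$. Families. A family $(b^i_j)_{i\in I,j\in J}$ is $\times$-functional if $\bigwedge_{i\in I}\bigwedge_{j,j'\in J}(b^i_j\times b^i_{j'}\to\delta_J(j,j'))\in\Sigma$. A family $(a_i)_{i\in I}$ of elements of $\mathcal{A}$ is: - $\mathbf{SK}$ if for every family of families $((b^i_j)_{j\in J_i})_{i\in I}$ of elements of $\mathcal{A}$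 with $\bigwedge_{i\in I}(a_i\to\exists_{j\in J_i}b^i_j)\in\Sigma$ there is $f\in\prod_{i\in I}J_i$ with $\bigwedge_{i\in I}(a_i\to b^i_{f(i)})\in\Sigma$; - $\mathbf{fSK}$ if for every $\times$-functional family $(b^i_j)_{i\in I,j\in J}$ with $\bigwedge_{i\in I}(a_i\to\exists_{j\in J}b^i_j)\in\Sigma$ there is a unique $f:I\to J$ with $\bigwedge_{i\in I}(a_i\to b^i_{f(i)})\in\Sigma$; - $\mathbf{wfSK}$ if the same holds with ''a unique $f$'' replaced by ''some $f$''; - $\mathbf{U\text{-}SK}$ (resp. $\mathbf{U\text{-}fSK}$, $\mathbf{U\text{-}wfSK}$) if $(a_{f(k)})_{k\in K}$ is $\mathbf{SK}$ (resp. $\mathbf{fSK}$, $\mathbf{wfSK}$) for every set $K$ and every function $f:K\to I$. These properties depend only on the class of $i\mapsto a_i$ in $\mathsf{P}(I)$ defined below. Implicative tripos. For a set $I$, $\mathsf{P}(I)$ is the posetal reflection of $\mathcal{A}^I$ preordered by: $\varphi\vdash\psi$ iff $\bigwedge_{i\in I}(\varphi(i)\to\psi(i))\in\Sigma$. It is a Heyting algebra with order written $\leq$ and meet $\wedge$ (represented by the pointwise $\times$). For $f:I\to X$, $\mathsf{P}_f:\mathsf{P}(X)\to\mathsf{P}(I)$ is precomposition with $f$; its left adjoint $\exists_f$ is represented by $(\exists_f\varphi)(x)=\exists_{i\in f^{-1}(x)}\varphi(i)$. Predicates are identified with representing functions. For a set $X$ with diagonal $\Delta_X$, $\delta_X:=\exists_{\Delta_X}(\top)\in\mathsf{P}(X\times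 X)$. Predicates. A predicate $\phi\in\mathsf{P}(I\times J)$ is functional if $\mathsf{P}_{\langle\pi_1,\pi_2\rangle}(\phi)\wedge\mathsf{P}_{\langle\pi_1,\pi_3\rangle}(\phi)\leq\mathsf{P}_{\langle\pi_2,\pi_3\rangle}(\delta_J)$, the projections being from $I\times J\times J$. A predicate $\varphi\in\mathsf{P}(I)$ is: - $\mathbf{SK_p}$ if whenever $\varphi\leq\exists_f(\psi)$ with $f:J\to I$ and $\psi\in\mathsf{P}(J)$, there is $g:I\to J$ with $\varphi\leq\mathsf{P}_g(\psi)$ and $f\circ g=\mathrm{id}_I$; - $\mathbf{fSK_p}$ if for every set $J$ and functional $\phi\in\mathsf{P}(I\times J)$ with $\varphi\leq\exists_{\pi_I}(\phi)$ there is a unique $f:I\to J$ with $\varphi\leq\mathsf{P}_{\langle\mathrm{id}_I,f\rangle}(\phi)$; - $\mathbf{wfSK_p}$ if the same holds with ''a unique $f$'' replaced by ''some $f$''; - $\mathbf{U\text{-}SK_p}$ (resp. $\mathbf{U\text{-}fSK_p}$, $\mathbf{U\text{-}wfSK_p}$) if $\mathsf{P}_f(\varphi)$ is $\mathbf{SK_p}$ (resp. $\mathbf{fSK_p}$, $\mathbf{wfSK_p}$) for every set $J$ and every function $f:J\to I$. *)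

(* Defs.v *)
From HB Require Import structures.
From mathcomp Require Import all_boot all_order.
From mathcomp Require Import boolp classical_sets.

Set Implicit Arguments.
Unset Strict Implicit.
Unset Printing Implicit Defensive.

Import Order.TTheory.
Local Open Scope classical_set_scope.
Local Open Scope order_scope.
Local Open Scope quotient_scope.

(* The category of sets. Naming the sort puts every quantification over sets
   below in one and the same universe. *)
Definition SET := Type.

Record completeLattice (d : Order.disp_t) := CompleteLattice {
  cl_sort :> tbLatticeType d;
  Inf : set cl_sort -> cl_sort;
  Sup : set cl_sort -> cl_sort;
  InfP : forall B : set cl_sort, infimums B (Inf B);
  SupP : forall B : set cl_sort, supremums B (Sup B)
}.

Definition bigInf (d : Order.disp_t) (A : completeLattice d) (I : Type)
  (F : I -> A) : A := Inf (range F).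

Notation "⋀ x .. y , F" := (bigInf (fun x => .. (bigInf (fun y => F)) ..))
  (at level 200, x binder, y binder, right associativity,
   format "⋀  x  ..  y ,  F").

Lemma Inf_lb (d : Order.disp_t) (A : completeLattice d)
  (B : set A) (a : A) : B a -> Inf B <= a.
Proof. by have [lb _] := InfP B; apply: lb. Qed.

Lemma Inf_glb (d : Order.disp_t) (A : completeLattice d)
  (B : set A) (a : A) : (forall b, B b -> a <= b) -> a <= Inf B.
Proof. by have [_ ub] := InfP B => aB; apply: ub. Qed.

Lemma bigInf_lb (d : Order.disp_t) (A : completeLattice d)
  (I : Type) (F : I -> A) (i : I) : bigInf F <= F i.
Proof. by apply: Inf_lb; exists i. Qed.

Lemma bigInf_glb (d : Order.disp_t) (A : completeLattice d)
  (I : Type) (F : I -> A) (a : A) :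
  (forall i, a <= F i) -> a <= bigInf F.
Proof. by move=> aF; apply: Inf_glb => _ [i _ <-]. Qed.

Record implicativeStructure (d : Order.disp_t) := ImplicativeStructure {
  is_sort :> completeLattice d;
  imp : is_sort -> is_sort -> is_sort;
  imp_mono : forall a a' b b' : is_sort,
    a' <= a -> b <= b' -> imp a b <= imp a' b';
  imp_Inf : forall (a : is_sort) (B : set is_sort),
    imp a (Inf B) = Inf [set imp a b | b in B]
}.

Notation "a ⇒ b" := (imp a b) (at level 60, right associativity).

Lemma imp_bigInf (d : Order.disp_t) (A : implicativeStructure d)
  (I : Type) (a : A) (F : I -> A) :
  (a ⇒ bigInf F) = ⋀ i, a ⇒ F i.
Proof.
rewrite /bigInf imp_Inf; congr Inf; apply/seteqP; split=> [_ [_ [i _ <-] <-]|].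
  by exists i.
by move=> _ [i _ <-]; exists (F i) => //; exists i.
Qed.

Record implicativeAlgebra (d : Order.disp_t) := ImplicativeAlgebra {
  ia_sort :> implicativeStructure d;
  sep : set ia_sort;
  sep_up : forall a b : ia_sort, a <= b -> sep a -> sep b;
  sep_K : sep (⋀ a b : ia_sort, a ⇒ b ⇒ a);
  sep_S : sep (⋀ a b c : ia_sort, (a ⇒ b ⇒ c) ⇒ (a ⇒ b) ⇒ a ⇒ c);
  sep_mp : forall a b : ia_sort, sep (a ⇒ b) -> sep a -> sep b
}.

Definition ia_times (d : Order.disp_t) (A : implicativeAlgebra d)
  (a b : A) : A := ⋀ x : A, (a ⇒ b ⇒ x) ⇒ x.

Notation "a ⊗ b" := (ia_times a b) (at level 40, left associativity).

Definition ia_ex (d : Order.disp_t) (A : implicativeAlgebra d) (I : SET)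
  (c : I -> A) : A := ⋀ x : A, (⋀ i : I, c i ⇒ x) ⇒ x.

Definition ia_delta (d : Order.disp_t) (A : implicativeAlgebra d) (J : SET)
  (j j' : J) : A :=
  if `[< j = j' >] then ⋀ x : A, (\top ⇒ x) ⇒ x else \top ⇒ \bot.

Section Families.
Variables (d : Order.disp_t) (A : implicativeAlgebra d).

Definition times_functional (I J : SET) (b : I -> J -> A) : Prop :=
  sep (⋀ i j j', b i j ⊗ b i j' ⇒ ia_delta A j j').

Definition SK (I : SET) (a : I -> A) : Prop :=
  forall (J : I -> SET) (b : forall i, J i -> A),
    sep (⋀ i, a i ⇒ ia_ex (b i)) ->
    exists f : forall i, J i, sep (⋀ i, a i ⇒ b i (f i)).

Definition fSK (I : SET) (a : I -> A) : Prop :=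
  forall (J : SET) (b : I -> J -> A),
    times_functional b ->
    sep (⋀ i, a i ⇒ ia_ex (b i)) ->
    exists! f : I -> J, sep (⋀ i, a i ⇒ b i (f i)).

Definition wfSK (I : SET) (a : I -> A) : Prop :=
  forall (J : SET) (b : I -> J -> A),
    times_functional b ->
    sep (⋀ i, a i ⇒ ia_ex (b i)) ->
    exists f : I -> J, sep (⋀ i, a i ⇒ b i (f i)).

Definition U_SK (I : SET) (a : I -> A) : Prop :=
  forall (K : SET) (f : K -> I), SK (a \o f).

Definition U_fSK (I : SET) (a : I -> A) : Prop :=
  forall (K : SET) (f : K -> I), fSK (a \o f).

Definition U_wfSK (I : SET) (a : I -> A) : Prop :=
  forall (K : SET) (f : K -> I), wfSK (a \o f).

End Families.

Section Tripos.
Variables (d : Order.disp_t) (A : implicativeAlgebra d).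

Lemma sep_mp_bigInf (I : Type) (F G : I -> A) :
  sep (⋀ i, F i ⇒ G i) -> sep (bigInf F) -> sep (bigInf G).
Proof.
move=> FG; apply: sep_mp; apply: sep_up FG; rewrite imp_bigInf.
apply: bigInf_glb => i; apply: le_trans (bigInf_lb _ i) _.
by apply: imp_mono => //; apply: bigInf_lb.
Qed.

Definition entails (I : SET) (phi psi : I -> A) : Prop :=
  sep (⋀ i, phi i ⇒ psi i).

Lemma entails_trans (I : SET) (phi psi chi : I -> A) :
  entails phi psi -> entails psi chi -> entails phi chi.
Proof.
move=> pq qr.
have pqr : sep (⋀ i, phi i ⇒ psi i ⇒ chi i).
  apply: sep_mp_bigInf qr; apply: sep_up (sep_K A).
  apply: bigInf_glb => i; apply: le_trans (bigInf_lb _ (psi i ⇒ chi i)) _.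
  exact: (bigInf_lb _ (phi i)).
apply: sep_mp_bigInf pq; apply: sep_mp_bigInf pqr; apply: sep_up (sep_S A).
apply: bigInf_glb => i; apply: le_trans (bigInf_lb _ (phi i)) _.
apply: le_trans (bigInf_lb _ (psi i)) _; exact: (bigInf_lb _ (chi i)).
Qed.

Lemma entails_refl (I : SET) (phi : I -> A) : entails phi phi.
Proof.
have K2 (psi : I -> A) : sep (⋀ i, phi i ⇒ psi i ⇒ phi i).
  apply: sep_up (sep_K A); apply: bigInf_glb => i.
  by apply: le_trans (bigInf_lb _ (phi i)) _; apply: (bigInf_lb _ (psi i)).
apply: sep_mp_bigInf (K2 phi).
apply: sep_mp_bigInf (K2 (fun i => phi i ⇒ phi i)).
apply: sep_up (sep_S A); apply: bigInf_glb => i.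
apply: le_trans (bigInf_lb _ (phi i)) _.
apply: le_trans (bigInf_lb _ (phi i ⇒ phi i)) _; exact: (bigInf_lb _ (phi i)).
Qed.

Definition pred_equiv (I : SET) : rel (I -> A) :=
  fun phi psi => `[< entails phi psi /\ entails psi phi >].

Lemma pred_equiv_is_equiv (I : SET) : equiv_class_of (@pred_equiv I).
Proof.
split=> [p|p q|q p r].
- by apply/asboolP; split; apply: entails_refl.
- by apply/asboolP/asboolP => -[].
- move=> /asboolP[pq qp] /asboolP[qr rq].
  by apply/asboolP; split; [apply: entails_trans qr | apply: entails_trans qp].
Qed.

Canonical pred_equiv_rel (I : SET) := EquivRelPack (pred_equiv_is_equiv I).

(* The posetal reflection of I -> A preordered by entailment. *)
Definition tripos (I : SET) : Type := {eq_quot (pred_equiv_rel I)}.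

HB.instance Definition _ (I : SET) := Choice.on (tripos I).
HB.instance Definition _ (I : SET) := Quotient.on (tripos I).

Definition pred_of (I : SET) (phi : I -> A) : tripos I := \pi phi.

Definition tripos_le (I : SET) : rel (tripos I) :=
  fun p q => `[< entails (repr p) (repr q) >].

Lemma tripos_le_refl (I : SET) : reflexive (@tripos_le I).
Proof. by move=> p; apply/asboolP; apply: entails_refl. Qed.

Lemma tripos_le_anti (I : SET) : antisymmetric (@tripos_le I).
Proof.
move=> p q /andP[/asboolP pq /asboolP qp].
by rewrite -[p]reprK -[q]reprK; apply/eqquotP/asboolP.
Qed.

Lemma tripos_le_trans (I : SET) : transitive (@tripos_le I).
Proof.
by move=> q p r /asboolP pq /asboolP qr; apply/asboolP; apply: entails_trans qr.
Qed.

Fact tripos_display : Order.disp_t. Proof. exact: Order.Disp tt tt. Qed.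

HB.instance Definition _ (I : SET) :=
  @Order.Le_isPOrder.Build tripos_display (tripos I) (@tripos_le I)
    (@tripos_le_refl I) (@tripos_le_anti I) (@tripos_le_trans I).

Lemma repr_pred_of (I : SET) (phi : I -> A) :
  entails (repr (pred_of phi)) phi /\ entails phi (repr (pred_of phi)).
Proof.
have /eqquotP : repr (pred_of phi) = phi %[mod_eq (pred_equiv_rel I)].
  by rewrite /pred_of reprK.
by move=> /asboolP.
Qed.

Lemma pred_of_le (I : SET) (phi psi : I -> A) :
  (pred_of phi <= pred_of psi) <-> entails phi psi.
Proof.
have [p1 p2] := repr_pred_of phi; have [q1 q2] := repr_pred_of psi.
split=> [/asboolP pq|pq].
  by apply: entails_trans q1; apply: entails_trans pq.
by apply/asboolP; apply: entails_trans q2; apply: entails_trans pq.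
Qed.

(* The operations below act on the chosen representatives [repr p]. Each of them
   is monotone for [entails], so the resulting class does not depend on that
   choice. *)
Definition tripos_top (I : SET) : tripos I := pred_of (fun _ => \top).

Definition tripos_meet (I : SET) (p q : tripos I) : tripos I :=
  pred_of (fun i => repr p i ⊗ repr q i).

Definition tripos_reindex (I X : SET) (f : I -> X) (p : tripos X) : tripos I :=
  pred_of (repr p \o f).

(* The left adjoint of [tripos_reindex f]. *)
Definition exists_along (I X : SET) (f : I -> X) (p : tripos I) : tripos X :=
  pred_of (fun x => ia_ex (fun i : {i : I | f i = x} => repr p (sval i))).

Definition tripos_delta (X : SET) : tripos (X * X)%type :=
  exists_along (fun x : X => (x, x)) (tripos_top X).

(* The product I * J * J is ((I * J) * J), so its projections are t.1.1, t.1.2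
   and t.2. *)
Definition functional_pred (I J : SET) (phi : tripos (I * J)%type) : Prop :=
  tripos_meet (tripos_reindex (fun t : I * J * J => (t.1.1, t.1.2)) phi)
              (tripos_reindex (fun t : I * J * J => (t.1.1, t.2)) phi)
  <= tripos_reindex (fun t : I * J * J => (t.1.2, t.2)) (tripos_delta J).

Definition SKp (I : SET) (phi : tripos I) : Prop :=
  forall (J : SET) (f : J -> I) (psi : tripos J),
    phi <= exists_along f psi ->
    exists g : I -> J, phi <= tripos_reindex g psi /\ f \o g = id.

Definition fSKp (I : SET) (phi : tripos I) : Prop :=
  forall (J : SET) (psi : tripos (I * J)%type),
    functional_pred psi ->
    phi <= exists_along fst psi ->
    exists! f : I -> J, phi <= tripos_reindex (fun i => (i, f i)) psi.

Definition wfSKp (I : SET) (phi : tripos I) : Prop :=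
  forall (J : SET) (psi : tripos (I * J)%type),
    functional_pred psi ->
    phi <= exists_along fst psi ->
    exists f : I -> J, phi <= tripos_reindex (fun i => (i, f i)) psi.

Definition U_SKp (I : SET) (phi : tripos I) : Prop :=
  forall (J : SET) (f : J -> I), SKp (tripos_reindex f phi).

Definition U_fSKp (I : SET) (phi : tripos I) : Prop :=
  forall (J : SET) (f : J -> I), fSKp (tripos_reindex f phi).

Definition U_wfSKp (I : SET) (phi : tripos I) : Prop :=
  forall (J : SET) (f : J -> I), wfSKp (tripos_reindex f phi).

End Tripos.

(* Main.v *)
Require Import Defs.
From mathcomp Require Import all_boot all_order.
From mathcomp Require Import boolp classical_sets.

(** The equivalences already hold before uniformising. Validity of a family,
   [sep (⋀ i, F i)], is closed under combinatory logic, so [ia_ex] and [⊗] obey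
   their usual adjunctions and respect entailment; hence the operations of the
   tripos may be computed on arbitrary representatives. A family of families
   [b i : J i -> A] is then the same thing as a predicate on [{i : I & J i}]
   together with the projection to [I], and, up to the representative of [\top],
   [tripos_delta J] is [ia_delta] on the nose. *)

Set Implicit Arguments.
Unset Strict Implicit.
Unset Printing Implicit Defensive.

Import Order.TTheory.
Local Open Scope order_scope.

Section Validity.
Variables (d : Order.disp_t) (A : implicativeAlgebra d).

(** * Combinatory logic for families valid uniformly in their index *)

Section Combinators.
Variable I : Type.
Implicit Types F G H : I -> A.

Lemma valid_K F G : sep (⋀ i, F i ⇒ G i ⇒ F i).
Proof.
apply: sep_up (sep_K A); apply: bigInf_glb => i.
by apply: le_trans (bigInf_lb _ (F i)) _; apply: (bigInf_lb _ (G i)).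
Qed.

Lemma valid_S F G H : sep (⋀ i, (F i ⇒ G i ⇒ H i) ⇒ (F i ⇒ G i) ⇒ F i ⇒ H i).
Proof.
apply: sep_up (sep_S A); apply: bigInf_glb => i.
apply: le_trans (bigInf_lb _ (F i)) _.
by apply: le_trans (bigInf_lb _ (G i)) _; apply: (bigInf_lb _ (H i)).
Qed.

Lemma valid_weaken F G : sep (⋀ i, G i) -> sep (⋀ i, F i ⇒ G i).
Proof. exact: sep_mp_bigInf (valid_K G F). Qed.

Lemma valid_mp F G H :
  sep (⋀ i, F i ⇒ G i ⇒ H i) -> sep (⋀ i, F i ⇒ G i) -> sep (⋀ i, F i ⇒ H i).
Proof.
move=> FGH; apply: sep_mp_bigInf; apply: sep_mp_bigInf FGH.
exact: valid_S.
Qed.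

Lemma valid_id F : sep (⋀ i, F i ⇒ F i).
Proof. exact: valid_mp (valid_K F (fun i => F i ⇒ F i)) (valid_K F F). Qed.

Lemma valid_comp F G H :
  sep (⋀ i, F i ⇒ G i) -> sep (⋀ i, G i ⇒ H i) -> sep (⋀ i, F i ⇒ H i).
Proof. by move=> FG GH; apply: valid_mp FG; apply: valid_weaken. Qed.

Lemma valid_swap F G H :
  sep (⋀ i, F i ⇒ G i ⇒ H i) -> sep (⋀ i, G i ⇒ F i ⇒ H i).
Proof.
move=> FGH; apply: (valid_comp (valid_K G F)).
by apply: sep_mp_bigInf FGH; apply: valid_S.
Qed.

Lemma valid_compI F G H : sep (⋀ i, (G i ⇒ H i) ⇒ (F i ⇒ G i) ⇒ F i ⇒ H i).
Proof. exact: valid_comp (valid_K _ F) (valid_S F G H). Qed.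

(** The rule [valid_swap] internalised as one implication: in [valid_app2] the exchange takes place
    under the hypothesis [F i]. *)
Lemma valid_swapI F G H : sep (⋀ i, (F i ⇒ G i ⇒ H i) ⇒ G i ⇒ F i ⇒ H i).
Proof.
apply: (valid_comp (valid_S F G H)).
have := valid_swap (valid_compI G (fun i => F i ⇒ G i) (fun i => F i ⇒ H i)).
by move/sep_mp_bigInf; apply; apply: valid_K.
Qed.

Lemma valid_app F G : sep (⋀ i, F i ⇒ (F i ⇒ G i) ⇒ G i).
Proof. by apply: valid_swap; apply: valid_id. Qed.

Lemma valid_app2 F G H : sep (⋀ i, F i ⇒ G i ⇒ (F i ⇒ G i ⇒ H i) ⇒ H i).
Proof.
apply: valid_comp (valid_app F (fun i => G i ⇒ H i)) _.
exact: valid_swapI.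
Qed.

Lemma valid_le F G : (forall i, F i <= G i) -> sep (⋀ i, F i ⇒ G i).
Proof.
move=> FG; apply: sep_up (valid_id F); apply: bigInf_glb => i.
by apply: le_trans (bigInf_lb _ i) _; apply: imp_mono.
Qed.

End Combinators.

(** Lets the combinators, which have a single index, act on doubly indexed infima. *)
Lemma bigInf_sigma (I : Type) (J : I -> Type) (F : forall i, J i -> A) :
  (⋀ s : {i : I & J i}, F (tag s) (tagged s)) = ⋀ i, ⋀ j, F i j.
Proof.
apply/le_anti/andP; split.
  apply: bigInf_glb => i; apply: bigInf_glb => j.
  exact: (bigInf_lb _ (existT _ i j)).
apply: bigInf_glb => -[i j] /=.
by apply: le_trans (bigInf_lb _ i) _; apply: bigInf_lb.
Qed.

Lemma ex_intro_valid (I : Type) (J : I -> SET) (c : forall i, J i -> A) :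
  sep (⋀ i, ⋀ j, c i j ⇒ ia_ex (c i)).
Proof.
(* Indexing by all pairs of elements of [A] gives one valid infimum that lies below the required
   instance for every [i], [j] and [x] at once. *)
apply: sep_up (valid_app (fun ax : A * A => ax.1) snd).
apply: bigInf_glb => i; apply: bigInf_glb => j; rewrite imp_bigInf.
apply: bigInf_glb => x; apply: le_trans (bigInf_lb _ (c i j, x)) _.
by apply: imp_mono => //; apply: imp_mono => //; apply: bigInf_lb.
Qed.

(** [ia_ex (c i)] lies below its instance at [x := e i]; exchanging the two premises leaves exactly
    the hypothesis to discharge. *)
Lemma ex_elim_valid (I : Type) (J : I -> SET) (c : forall i, J i -> A)
  (e : I -> A) :
  sep (⋀ i, ⋀ j, c i j ⇒ e i) -> sep (⋀ i, ia_ex (c i) ⇒ e i).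
Proof.
move=> ce; apply: sep_mp_bigInf ce; apply: valid_swap; apply: valid_le => i.
exact: (bigInf_lb _ (e i)).
Qed.

Lemma ex_mono_valid (I : Type) (J : I -> SET) (b c : forall i, J i -> A) :
  sep (⋀ i, ⋀ j, b i j ⇒ c i j) -> sep (⋀ i, ia_ex (b i) ⇒ ia_ex (c i)).
Proof.
move=> bc; apply: ex_elim_valid; have := ex_intro_valid c.
rewrite -!(bigInf_sigma (fun i j => _ ⇒ _)) in bc *.
exact: valid_comp.
Qed.

Lemma times_intro_valid (I : Type) (a b : I -> A) :
  sep (⋀ i, a i ⇒ b i ⇒ a i ⊗ b i).
Proof.
apply: sep_up (valid_app2 (fun t : A * A * A => t.1.1) (fun t => t.1.2) snd).
apply: bigInf_glb => i; rewrite !imp_bigInf; apply: bigInf_glb => x.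
exact: (bigInf_lb _ (a i, b i, x)).
Qed.

Lemma times_mono_valid (I : Type) (a b a' b' : I -> A) :
  sep (⋀ i, a i ⇒ a' i) -> sep (⋀ i, b i ⇒ b' i) ->
  sep (⋀ i, a i ⊗ b i ⇒ a' i ⊗ b' i).
Proof.
move=> aa' bb'.
have abz : sep (⋀ i, a i ⇒ b i ⇒ a' i ⊗ b' i).
  apply: valid_swap; apply: (valid_comp bb'); apply: valid_swap.
  by apply: (valid_comp aa'); apply: times_intro_valid.
apply: sep_mp_bigInf abz; apply: valid_swap; apply: valid_le => i.
exact: (bigInf_lb _ (a' i ⊗ b' i)).
Qed.

Lemma ia_ex_le (I J : SET) (b : I -> A) (c : J -> A) :
  (forall i, exists j, b i = c j) -> ia_ex b <= ia_ex c.
Proof.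
move=> bc; apply: bigInf_glb => x; apply: le_trans (bigInf_lb _ x) _.
apply: imp_mono => //; apply: bigInf_glb => i; have [j ->] := bc i.
exact: bigInf_lb.
Qed.

(** Only the set of values matters, so a fibre can be traded for a plain index type without building
    a bijection. *)
Lemma ia_ex_eq (I J : SET) (b : I -> A) (c : J -> A) :
  (forall i, exists j, b i = c j) -> (forall j, exists i, c j = b i) ->
  ia_ex b = ia_ex c.
Proof. by move=> bc cb; apply/le_anti/andP; split; apply: ia_ex_le. Qed.

(** On the diagonal the fibre is inhabited and the inner infimum is [\top ⇒ x]. Off it the fibre is
    empty and the inner infimum is [\top], leaving the infimum of [\top ⇒ x] over all [x]. *)
Lemma ia_ex_diag (J : SET) (p : J * J) :
  ia_ex (fun _ : {j : J | (j, j) = p} => \top) = ia_delta A p.1 p.2.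
Proof.
case: p => j j' /=; rewrite /ia_delta; case: asboolP => [<-|jj'].
  congr bigInf; apply/funext => x; congr (_ ⇒ _); apply/le_anti/andP; split.
    exact: (bigInf_lb _ (exist _ j erefl)).
  exact: bigInf_glb.
have empty_top (x : A) : (⋀ _ : {k : J | (k, k) = (j, j')}, \top ⇒ x) = \top.
  apply/le_anti; rewrite lex1; apply: bigInf_glb => -[k [kj kj']].
  by case: jj'; rewrite -kj.
(* Writing [\bot] as an infimum lets [imp_bigInf] distribute [\top ⇒ _] over it. *)
have -> : (\bot : A) = ⋀ x : A, x.
  by apply/le_anti; rewrite le0x /=; apply: bigInf_lb.
rewrite imp_bigInf /ia_ex; congr bigInf; apply/funext => x.
by rewrite empty_top.
Qed.

End Validity.

(** * Tripos operations and supercompactness computed on representatives *)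

Section Representatives.
Variables (d : Order.disp_t) (A : implicativeAlgebra d).

Lemma pred_of_eq (I : SET) (phi psi : I -> A) :
  entails phi psi -> entails psi phi -> pred_of phi = pred_of psi.
Proof. by move=> pq qp; apply/le_anti/andP; split; apply/pred_of_le. Qed.

Lemma pred_of_repr (I : SET) (p : tripos A I) : pred_of (repr p) = p.
Proof. exact: reprK. Qed.

Lemma entails_comp (I X : SET) (f : I -> X) (phi psi : X -> A) :
  entails phi psi -> entails (phi \o f) (psi \o f).
Proof. by apply: sep_up; apply: bigInf_glb => i; apply: (bigInf_lb _ (f i)). Qed.

Lemma reindex_pred_of (I X : SET) (f : I -> X) (phi : X -> A) :
  tripos_reindex f (pred_of phi) = pred_of (phi \o f).
Proof.
have [p1 p2] := repr_pred_of phi.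
by apply: pred_of_eq; apply: entails_comp.
Qed.

Lemma meet_pred_of (I : SET) (phi psi : I -> A) :
  tripos_meet (pred_of phi) (pred_of psi) = pred_of (fun i => phi i ⊗ psi i).
Proof.
have [p1 p2] := repr_pred_of phi; have [q1 q2] := repr_pred_of psi.
by apply: pred_of_eq; apply: times_mono_valid.
Qed.

Lemma exists_along_pred_of (I X : SET) (f : I -> X) (psi : I -> A) :
  exists_along f (pred_of psi) =
  pred_of (fun x => ia_ex (fun i : {i : I | f i = x} => psi (sval i))).
Proof.
have ex_mono (p q : I -> A) : entails p q ->
    entails (fun x => ia_ex (fun i : {i : I | f i = x} => p (sval i)))
            (fun x => ia_ex (fun i : {i : I | f i = x} => q (sval i))).
  move=> pq; apply: ex_mono_valid; apply: sep_up pq.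
  by apply: bigInf_glb => x; apply: bigInf_glb => i; apply: (bigInf_lb _ (sval i)).
have [p1 p2] := repr_pred_of psi.
by apply: pred_of_eq; apply: ex_mono.
Qed.

Lemma exists_along_fst (I J : SET) (psi : I * J -> A) :
  exists_along fst (pred_of psi) =
  pred_of (fun i => ia_ex (fun j : J => psi (i, j))).
Proof.
rewrite exists_along_pred_of; congr pred_of; apply/funext => i.
apply: ia_ex_eq => [[[i' j] /= <-]|j]; first by exists j.
by exists (exist (fun p : I * J => p.1 = i) (i, j) erefl).
Qed.

Lemma tripos_deltaE (J : SET) :
  tripos_delta A J = pred_of (fun p : J * J => ia_delta A p.1 p.2).
Proof.
rewrite /tripos_delta exists_along_pred_of; congr pred_of.
by apply/funext => p; apply: ia_ex_diag.
Qed.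

Lemma functional_pred_of (I J : SET) (psi : I * J -> A) :
  functional_pred (pred_of psi) <-> times_functional (fun i j => psi (i, j)).
Proof.
rewrite /functional_pred tripos_deltaE !reindex_pred_of meet_pred_of pred_of_le.
suff E : (⋀ t : I * J * J, psi (t.1.1, t.1.2) ⊗ psi (t.1.1, t.2) ⇒
                          ia_delta A t.1.2 t.2) =
         ⋀ i j j', psi (i, j) ⊗ psi (i, j') ⇒ ia_delta A j j'.
  by rewrite /times_functional -E.
apply/le_anti/andP; split.
  do 3![apply: bigInf_glb => ?]; exact: (bigInf_lb _ (_, _, _)).
apply: bigInf_glb => -[[i j] j'] /=; apply: le_trans (bigInf_lb _ i) _.
by apply: le_trans (bigInf_lb _ j) _; apply: bigInf_lb.
Qed.

(** Choice functions for [J] are the sections of [tag : {i : I & J i} -> I]; conversely, the fibres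
    of any [f] form a family of index sets. *)
Lemma SKpP (I : SET) (phi : I -> A) : SKp (pred_of phi) <-> SK phi.
Proof.
split=> [phiSK J b phib|phiSK J f psi].
  pose psi (s : {i : I & J i}) := b (tag s) (tagged s).
  have := phiSK {i : I & J i} (fun s => tag s) (pred_of psi).
  rewrite exists_along_pred_of.
  have -> : (fun i => ia_ex (fun s : {s : {i : I & J i} | tag s = i} =>
                              psi (sval s))) = (fun i => ia_ex (b i)).
    apply/funext => i; apply: ia_ex_eq => [[[i' j] /= ii']|j].
      by case: _ / ii'; exists j.
    by exists (exist (fun s : {i & J i} => tag s = i) (existT _ i j) erefl).
  case=> [|g []]; first exact/pred_of_le.
  rewrite reindex_pred_of => /pred_of_le phig tag_g.
  (* The second component of [g i] lives over [tag (g i)] and is transported to [J i]; that equation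
     is generalised so that it can be eliminated. *)
  have [f gE] : exists f : forall i, J i, g = fun i => existT J i (f i).
    have tagg i : tag (g i) = i by rewrite -[RHS](congr1 (@^~ i) tag_g).
    exists (fun i => ecast i (J i) (tagg i) (tagged (g i))); apply/funext => i.
    by move: (tagg i); case: (g i) => i' j /= ii'; case: _ / ii'.
  by exists f; rewrite gE in phig.
(* Supercompactness is applied to the fibres of [f]: a chosen point carries both the value of the
   section and the proof that [f] maps it to [i]. *)
rewrite -[psi]pred_of_repr exists_along_pred_of => /pred_of_le /phiSK[g phig].
exists (fun i => sval (g i)); split; last first.
  by apply/funext => i; apply: (svalP (g i)).
by rewrite reindex_pred_of; apply/pred_of_le.
Qed.

(** An equality of propositions rather than an equivalence, so that [funext] carries it under an
    arbitrary [Q]. *)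
Lemma reindex_graph_le (I J : SET) (phi : I -> A) (psi : I * J -> A)
    (f : I -> J) :
  (pred_of phi <= tripos_reindex (fun i => (i, f i)) (pred_of psi)) =
  sep (⋀ i, phi i ⇒ psi (i, f i)) :> Prop.
Proof. by rewrite reindex_pred_of; apply/propext; apply: pred_of_le. Qed.

(* [Q] is instantiated by the two modes of existence, [exists!] and [exists]. *)
Lemma functional_choiceP (Q : forall T : SET, (T -> Prop) -> Prop) (I : SET)
    (phi : I -> A) :
  (forall (J : SET) (psi : tripos A (I * J)%type),
     functional_pred psi -> pred_of phi <= exists_along fst psi ->
     Q (I -> J) (fun f => pred_of phi <= tripos_reindex (fun i => (i, f i)) psi)) <->
  (forall (J : SET) (b : I -> J -> A),
     times_functional b -> sep (⋀ i, phi i ⇒ ia_ex (b i)) ->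
     Q (I -> J) (fun f => sep (⋀ i, phi i ⇒ b i (f i)))).
Proof.
split=> [phiQ J b fb phib|phiQ J psi].
  have := phiQ J (pred_of (fun p => b p.1 p.2)).
  rewrite (functional_pred_of (fun p => b p.1 p.2)) exists_along_fst pred_of_le.
  move=> /(_ fb phib); congr Q; apply/funext => f; exact: reindex_graph_le.
rewrite -[psi]pred_of_repr functional_pred_of exists_along_fst pred_of_le.
move=> fb phib; have := phiQ J _ fb phib.
congr Q; apply/funext => f; exact/esym/reindex_graph_le.
Qed.

Lemma fSKpP (I : SET) (phi : I -> A) : fSKp (pred_of phi) <-> fSK phi.
Proof. exact: (functional_choiceP (fun T P => exists! f : T, P f)). Qed.

Lemma wfSKpP (I : SET) (phi : I -> A) : wfSKp (pred_of phi) <-> wfSK phi.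
Proof. exact: (functional_choiceP (fun T P => exists f : T, P f)). Qed.

End Representatives.

Theorem proposition4p11 (d : Order.disp_t) (A : implicativeAlgebra d)
    (I : SET) (phi : I -> A) :
  (U_SKp (pred_of phi) <-> U_SK phi) /\
  (U_fSKp (pred_of phi) <-> U_fSK phi) /\
  (U_wfSKp (pred_of phi) <-> U_wfSK phi).
Proof.
(* Reindexing along [f] represents [phi \o f], so the non-uniform equivalences apply at each [f]
   separately. *)
split; [|split]; split=> phiU K f; have := phiU K f; rewrite reindex_pred_of.
- by move/SKpP.
- by move/SKpP.
- by move/fSKpP.
- by move/fSKpP.
- by move/wfSKpP.
- by move/wfSKpP.
Qed.
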